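(* Let $X$ be a real Banach space such that $\operatorname{span}(\mathrm{NA}(X))$ is a weak-star modest subspace of $X^*$. Then $X$ possesses an equivalent Read norm $p$. Moreover, $p$ can be chosen in such a way that, given any two linearly independent functionals $x^*, z^* \in \mathrm{NA}(X,p)$ with $p^*(x^* ) = p^*(z^* ) = 1$, one has $x^* + z^* \notin \mathrm{NA}(X,p)$ or $x^* - z^* \notin \mathrm{NA}(X,p)$.
   Context: All Banach spaces are real. For a Banach space $(X,\|\cdot\|)$, $\mathrm{NA}(X)=\mathrm{NA}(X,\|\cdot\|)$ is the set of all $f\in X^*$ that attain their norm, i.e. $\|f\|=|f(x)|$ for some $x$ in the unit sphere $S_X$. For an equivalent norm $p$ on $X$, $p^*$ denotes the dual norm on $X^*$, and $\mathrm{NA}(X,p)$ is the set of functionals attaining their norm when $X$ is endowed with $p$. An equivalent norm $p$ on $X$ is a Read norm if $\mathrm{NA}(X,p)$ does not contain any two-dimensional linear subspace. A linear subspace $Y$ of a Banach space $V$ is an operator range if there are an infinite-dimensional Banach space $E$ and a bounded injective linear operator $T\colon E\to V$ with $T(E)=Y$. A linear subspace $Z$ of a dual Banach space $X^*$ is weak-star modest if there is a (norm-)separable weak-star dense operator range $Y\subset X^*$ with $Z\cap Y=\{0\}$. *)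

(* Defs.v *)
From HB Require Import structures.
From mathcomp Require Import all_boot all_order all_algebra.
From mathcomp Require Import all_classical all_reals all_analysis.

Set Implicit Arguments.
Unset Strict Implicit.
Unset Printing Implicit Defensive.

Import Order.TTheory GRing.Theory Num.Theory.
Import numFieldNormedType.Exports.

Local Open Scope classical_set_scope.
Local Open Scope ring_scope.

Section linear_algebra.
Context {R : realType} {V : lmodType R}.

Definition lin_subspace (A : set V) : Prop := submod_closed [pred x in A].

Definition lin_span (A : set V) : set V := smallest lin_subspace A.

Definition lin_indep n (b : n.-tuple V) : Prop :=
  forall c : 'I_n -> R, \sum_(i < n) c i *: tnth b i = 0 -> forall i, c i = 0.

Definition has_dim (A : set V) (n : nat) : Prop :=
  exists2 b : n.-tuple V, lin_indep b & A = lin_span [set` b].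

End linear_algebra.

Definition infinite_dimensional (R : realType) (V : lmodType R) : Prop :=
  ~ exists n, has_dim [set: V] n.

Section dual_space.
Context {R : realType} (X : normedModType R).

Definition linear_continuous_fun : {pred X -> R} :=
  fun f => `[< linear f /\ continuous f >].

Record dual_space := DualSpace {
  dual_fun :> X -> R ;
  dual_funP : dual_fun \in linear_continuous_fun }.

HB.instance Definition _ := [isSub for dual_fun].
HB.instance Definition _ := gen_eqMixin dual_space.
HB.instance Definition _ := gen_choiceMixin dual_space.

Lemma linear_continuous_fun_submod_closed :
  submod_closed linear_continuous_fun.
Proof.
split.
  apply/asboolP; split; last by move=> x; exact: cvg_cst.
  by move=> a x y; rewrite /GRing.zero/= scaler0 addr0.
move=> a f g /asboolP[lf cf] /asboolP[lg cg]; apply/asboolP; split.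
  move=> b x y; rewrite !fctE lf lg !scalerDr !scalerA (mulrC a b).
  by rewrite addrACA.
by move=> x; apply: cvgD; [apply: cvgM; [exact: cvg_cst|exact: cf]|exact: cg].
Qed.

HB.instance Definition _ := GRing.isSubmodClosed.Build _ _
  linear_continuous_fun linear_continuous_fun_submod_closed.
HB.instance Definition _ := [SubChoice_isSubLmodule of dual_space by <:].

Lemma dual_fun_linear (f : dual_space) : linear (f : X -> R).
Proof. by have /asboolP[] := dual_funP f. Qed.

HB.instance Definition _ (f : dual_space) :=
  GRing.isLinear.Build R X R _ (dual_fun f) (@dual_fun_linear f).

Lemma dual_fun_continuous (f : dual_space) : continuous (f : X -> R).
Proof. by have /asboolP[] := dual_funP f. Qed.

Lemma dual_spaceD (f g : dual_space) x : (f + g) x = f x + g x.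
Proof. by []. Qed.

Lemma dual_spaceZ a (f : dual_space) x : (a *: f) x = a * f x.
Proof. by []. Qed.

Lemma dual_spaceB (f g : dual_space) x : (f - g) x = f x - g x.
Proof. by []. Qed.

(* For a norm p equivalent to that of X, this is the dual norm p^* on X^*. *)
Definition dual_norm (p : X -> R) (f : dual_space) : R :=
  sup [set `|f x| | x in [set x | p x <= 1]].

Lemma dual_norm_has_sup (f : dual_space) :
  has_sup [set `|f x| | x in [set x | `|x| <= 1]].
Proof.
split; first by exists `|f 0|; exists 0 => //=; rewrite normr0.
have /linear_bounded_continuous/bounded_funP/(_ 1)[M fM] :=
  @dual_fun_continuous f.
by exists M => _ [x /= x1 <-]; exact: fM.
Qed.

Lemma le_dual_norm (f : dual_space) x :
  `|f x| <= dual_norm Num.norm f * `|x|.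
Proof.
have [->|x0] := eqVneq x 0; first by rewrite linear0 !normr0 mulr0.
rewrite -ler_pdivrMr ?normr_gt0//.
have -> : `|f x| / `|x| = `|f (`|x|^-1 *: x)|.
  by rewrite linearZ/= normrM normfV normr_id mulrC.
apply: (sup_upper_bound (dual_norm_has_sup f)).
exists (`|x|^-1 *: x) => //=.
by rewrite normrZ normfV normr_id mulVf ?normr_eq0.
Qed.

Lemma dual_norm_le (f : dual_space) M :
  0 <= M -> (forall x, `|f x| <= M * `|x|) -> dual_norm Num.norm f <= M.
Proof.
move=> M0 fM; apply: ge_sup; first by case: (dual_norm_has_sup f).
move=> _ [x /= x1 <-]; rewrite (le_trans (fM x))//.
by rewrite -[leRHS]mulr1 ler_wpM2l.
Qed.

Lemma dual_norm_ge0 (f : dual_space) : 0 <= dual_norm Num.norm f.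
Proof.
apply: (sup_upper_bound (dual_norm_has_sup f)).
by exists 0 => /=; rewrite ?linear0 normr0.
Qed.

Lemma ler_dual_normD (f g : dual_space) :
  dual_norm Num.norm (f + g) <= dual_norm Num.norm f + dual_norm Num.norm g.
Proof.
apply: dual_norm_le => [|x]; first by rewrite addr_ge0 ?dual_norm_ge0.
by rewrite mulrDl (le_trans (ler_normD _ _))// lerD ?le_dual_norm.
Qed.

Lemma dual_normZ a (f : dual_space) :
  dual_norm Num.norm (a *: f) = `|a| * dual_norm Num.norm f.
Proof.
have le b g : dual_norm Num.norm (b *: g) <= `|b| * dual_norm Num.norm g.
  apply: dual_norm_le => [|x]; first by rewrite mulr_ge0 ?dual_norm_ge0.
  by rewrite dual_spaceZ normrM -mulrA ler_wpM2l ?le_dual_norm.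
apply/eqP; rewrite eq_le le/=; have [->|a0] := eqVneq a 0.
  by rewrite normr0 mul0r dual_norm_ge0.
rewrite -[in leLHS](scalerK a0 f) (le_trans (ler_wpM2l _ (le _ _)))//.
by rewrite normfV mulVKf ?normr_eq0.
Qed.

Lemma dual_norm_eq0 (f : dual_space) : dual_norm Num.norm f = 0 -> f = 0.
Proof.
move=> f0; apply/val_inj/funext => x /=; apply/eqP.
by rewrite -normr_le0 (le_trans (le_dual_norm _ _))// f0 mul0r.
Qed.

HB.instance Definition _ := Lmodule_isNormed.Build R dual_space
  ler_dual_normD dual_normZ dual_norm_eq0.

Lemma dual_space_complete (F : set_system dual_space) :
  ProperFilter F -> cauchy F -> cvg F.
Proof.
move=> FF /cauchy_ballP cF.
have Fx x : cvg ((fun f : dual_space => f x : R) @ F).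
  apply/cauchy_cvgP/cauchy_ballP => _/posnumP[e].
  have c0 : 0 < e%:num / (`|x| + 1) by rewrite divr_gt0 ?ltr_wpDl.
  rewrite near_map2; apply: filterS (cF _ c0) => -[f g] /=.
  rewrite -ball_normE/= => fg; rewrite -ball_normE/= -dual_spaceB.
  rewrite (le_lt_trans (le_dual_norm _ _))//.
  apply: (@le_lt_trans _ _ (e%:num / (`|x| + 1) * `|x|)).
    by rewrite ler_wpM2r// ltW.
  by rewrite mulrAC ltr_pdivrMr ?ltr_wpDl// ltr_pM2l// ltrDl.
pose l x : R := lim ((fun f : dual_space => f x : R) @ F).
have Fl x : (fun f : dual_space => f x : R) @ F --> l x by exact: Fx.
have approx e : 0 < e ->
    exists2 f0, F (ball f0 e) & forall x, `|f0 x - l x| <= e * `|x|.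
  move=> e0; have /cauchy_ballP/cauchyP/(_ _ e0)[f0 Ff0] := cF.
  exists f0 => // x.
  have cl : closed (closed_ball_ Num.norm (f0 x) (e * `|x|)).
    exact: closed_closed_ball_.
  apply: (closed_cvg _ cl _ _ (Fl x)).
  apply: filterS Ff0 => f; rewrite -ball_normE/= => f0f.
  rewrite /closed_ball_/= -dual_spaceB (le_trans (le_dual_norm _ _))//.
  by rewrite ler_wpM2r// ltW.
have ll : linear l.
  move=> a x y; apply: (cvg_unique _ (Fl _)) => //.
  rewrite (_ : (fun f : dual_space => _) =
    (fun f : dual_space => a * (f x : R) + f y)); last first.
    by apply/funext => f; rewrite linearP.
  by apply: cvgD; [apply: cvgM; [exact: cvg_cst|exact: Fl]|exact: Fl].
pose L : {linear X -> R} := HB.pack l (GRing.isLinear.Build R X R _ l ll).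
have cl : continuous l.
  apply: (@bounded_linear_continuous _ _ _ L); apply/bounded_funP => r.
  have [f0 _ f0l] := approx 1 ltr01.
  have /linear_bounded_continuous/bounded_funP/(_ r)[M f0M] :=
    @dual_fun_continuous f0.
  exists (M + r) => x xr; rewrite /L/= -[l x](subrK (f0 x)) addrC.
  rewrite (le_trans (ler_normD _ _))// lerD ?f0M// distrC.
  by rewrite (le_trans (f0l x))// mul1r.
pose g := @DualSpace l (asboolT (conj ll cl)).
apply/cvg_ex; exists g; apply/cvgrPdist_le => /= e e0.
have e20 : 0 < e / 2 by rewrite divr_gt0.
have [f0 Ff0 f0l] := approx _ e20.
apply: filterS Ff0 => f; rewrite -ball_normE/= => f0f.
rewrite -(subrKA f0) (le_trans (ler_normD _ _))// [leRHS](splitr e) lerD//.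
  by apply: dual_norm_le => [|x]; [exact: ltW|rewrite distrC; exact: f0l].
exact: ltW.
Qed.

HB.instance Definition _ :=
  Uniform_isComplete.Build dual_space dual_space_complete.

(* The map f |-> (f x)_x into R^X with the topology of pointwise convergence
   induces the weak-star topology. *)
Definition weak_star : Type :=
  initial_topology (fun f : dual_space => (f : {ptws X -> R})).

HB.instance Definition _ := Topological.on weak_star.

End dual_space.

Definition separable_set (T : topologicalType) (A : set T) : Prop :=
  exists D : set T, [/\ countable D, D `<=` A & A `<=` closure D].

Section equivalent_norms.
Context {R : realType} {X : normedModType R}.

Definition is_norm (p : X -> R) : Prop :=
  [/\ forall x y, p (x + y) <= p x + p y,
      forall (a : R) x, p (a *: x) = `|a| * p x
    & forall x, p x = 0 -> x = 0].

Definition equivalent_norm (p : X -> R) : Prop :=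
  is_norm p /\
  exists c C : R, [/\ 0 < c, 0 < C & forall x, c * `|x| <= p x <= C * `|x|].

Definition NA (p : X -> R) : set (dual_space X) :=
  [set f | exists2 x, p x = 1 & dual_norm p f = `|f x| ].

Definition Read_norm (p : X -> R) : Prop :=
  equivalent_norm p /\
  ~ exists2 M : set (dual_space X), has_dim M 2 & M `<=` NA p.

End equivalent_norms.

Definition operator_range (R : realType) (V : completeNormedModType R)
    (Y : set V) : Prop :=
  lin_subspace Y /\
  exists (E : completeNormedModType R) (T : {linear E -> V}),
    [/\ infinite_dimensional E, bounded_near T (nbhs (0 : E)), injective T
      & range T = Y].

Definition weak_star_modest (R : realType) (X : normedModType R)
    (Z : set (dual_space X)) : Prop :=
  lin_subspace Z /\
  exists Y : set (dual_space X),
    [/\ operator_range Y, separable_set Y, dense (Y : set (weak_star X))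
      & Z `&` Y = [set 0]].

(* Main.v *)
Require Import Defs.
From mathcomp Require Import all_boot all_order all_algebra.
From mathcomp Require Import all_classical all_reals all_analysis.
From mathcomp Require Import ring lra.

Import Order.TTheory GRing.Theory Num.Theory.
Import numFieldNormedType.Exports.

Local Open Scope classical_set_scope.
Local Open Scope ring_scope.

(** Let [T : E -> X^*] be injective with range the separable weak-star dense
    space Y.  The new norm is [p x = |x| + sum_n |T (h n) x|], where the
    [h n] tend to 0 fast and their directions are dense in Y.

    If [f] attains its p-norm 1 at [z], then splitting off one functional at a
    time gives [f = u + T g] with [u] in NA(X), [g = sum_n a_n h_n],
    [|a_n| <= 1], and [|a_n| = 1] as soon as [T (h n) z <> 0].  Suppose that
    f1, f2, f1 + f2 = al f3 and f1 - f2 = be f4 are all p-norm attaining.  As Y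
    meets the span of NA(X) trivially, the Y-parts satisfy the same relations,
    and so do the coefficients, because the [h n] are chosen so that a bounded
    coefficient sequence is determined by its sum.  Density of the directions
    gives an index n with [T (h n)] nonzero at the four attaining points; there
    the coefficients of f1 and f2 are [+1] or [-1], so that one of their sum
    and difference vanishes, whereas al and be times a sign do not. *)

(** * Recursive choice, small scalars and evaluation of functionals *)

(** Each value may depend on the whole list [mkseq u n] of earlier ones; a choice function is
    iterated by appending its value to that list. *)
Lemma seq_choice (A : Type) (P : seq A -> A -> Prop) :
  (forall s, exists a, P s a) ->
  exists u : nat -> A, forall n, P (mkseq u n) (u n).
Proof.
move=> /choice[g gP].
pose pre := fix pre n := if n is m.+1 then rcons (pre m) (g (pre m)) else [::].
exists (fun n => g (pre n)) => n.
suff -> : mkseq (fun n => g (pre n)) n = pre n by exact: gP.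
by elim: n => //= n IHn; rewrite mkseqS IHn.
Qed.

(** Collects finitely many smallness demands into one factor; [b] may have either sign or vanish,
    whence the [+ 1] in the denominators. *)
Lemma small_scalar (R : realType) (s : seq (R * R)) :
  (forall a b, (a, b) \in s -> 0 < a) ->
  exists2 r : R, 0 < r & forall a b, (a, b) \in s -> r * b < a.
Proof.
elim: s => [|[a b] s IHs] sP; first by exists 1.
have [|r r0 rP] := IHs.
  by move=> a' b' abs; apply: (sP a' b'); rewrite inE abs orbT.
have a0 : 0 < a by apply: (sP a b); rewrite mem_head.
have b0 : 0 < `|b| + 1 by rewrite ltr_wpDl.
exists (Num.min r (a / (`|b| + 1) )) => [|a' b'].
  by rewrite lt_min r0 divr_gt0.
have m0 : 0 < Num.min r (a / (`|b| + 1)) by rewrite lt_min r0 divr_gt0.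
rewrite inE => /predU1P[[-> ->]|abs].
  apply: (@le_lt_trans _ _ (Num.min r (a / (`|b| + 1)) * `|b|)).
    by rewrite ler_pM2l// ler_norm.
  apply: (@le_lt_trans _ _ (a / (`|b| + 1) * `|b|)).
    by rewrite ler_wpM2r// ge_min lexx orbT.
  by rewrite mulrAC ltr_pdivrMr// ltr_pM2l// ltrDl.
have a'0 : 0 < a' by apply: (sP a' b'); rewrite inE abs orbT.
have [b'0|b'0] := ltP 0 b'.
  by apply: le_lt_trans (rP _ _ abs); rewrite ler_pM2r// ge_min lexx.
by apply: le_lt_trans a'0; rewrite pmulr_rle0.
Qed.

Lemma dual_funZ (R : realType) (X : normedModType R) (f : dual_space X)
  a x : f (a *: x) = a * f x.
Proof. by rewrite linearZ. Qed.

Lemma dual_space_sum (R : realType) (X : normedModType R) n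
  (F : nat -> dual_space X) x : (\sum_(i < n) F i) x = \sum_(i < n) F i x.
Proof.
elim: n => [|n IHn]; first by rewrite !big_ord0.
by rewrite !big_ord_recr -IHn.
Qed.

Section operators_into_dual.
Context {R : realType} {X : normedModType R} {E : lmodType R}.
Variable T : {linear E -> dual_space X}.

Lemma opD e f x : T (e + f) x = T e x + T f x.
Proof. by rewrite linearD. Qed.

Lemma opZ a e x : T (a *: e) x = a * T e x.
Proof. by rewrite linearZ. Qed.

Lemma opB e f x : T (e - f) x = T e x - T f x.
Proof. by rewrite linearB. Qed.

Lemma op_sum n (F : nat -> E) x :
  T (\sum_(i < n) F i) x = \sum_(i < n) T (F i) x.
Proof. by rewrite linear_sum (dual_space_sum _ _ _ (T \o F)). Qed.

End operators_into_dual.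

(** * Linear subspaces, finite spans and common kernels *)

Section subspaces.
Context {R : realType}.

Lemma lin_subspaceP {V : lmodType R} (A : set V) : lin_subspace A <->
  A 0 /\ forall a x y, A x -> A y -> A (a *: x + y).
Proof.
split=> [[/=]|[A0 AP]]; rewrite ?inE; first move=> A0 AP.
  split=> // a x y Ax Ay.
  by have /(_ a x y) := AP; rewrite !inE; exact.
by split=> [|a x y] /=; rewrite !inE//; exact: AP.
Qed.

Lemma lin_span_subspace {V : lmodType R} (A : set V) :
  lin_subspace (lin_span A).
Proof.
apply/lin_subspaceP; split=> [B [/lin_subspaceP[]]//|a x y Ax Ay B BA].
have /lin_subspaceP[_ BP] := BA.1; apply: BP; [exact: Ax|exact: Ay].
Qed.

Lemma sub_lin_span {V : lmodType R} (A : set V) : A `<=` lin_span A.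
Proof. exact: sub_smallest. Qed.

Lemma lin_span_sub {V : lmodType R} (A B : set V) :
  lin_subspace B -> A `<=` B -> lin_span A `<=` B.
Proof. exact: smallest_sub. Qed.

Lemma lin_subspaceZ {V : lmodType R} (A : set V) a x :
  lin_subspace A -> A x -> A (a *: x).
Proof.
by move=> /lin_subspaceP[A0 AP] Ax; rewrite -[_ *: _]addr0; exact: AP.
Qed.

Lemma lin_subspaceD {V : lmodType R} (A : set V) x y :
  lin_subspace A -> A x -> A y -> A (x + y).
Proof.
by move=> /lin_subspaceP[A0 AP] Ax Ay; rewrite -[x]scale1r; exact: AP.
Qed.

Lemma lin_subspaceB {V : lmodType R} (A : set V) x y :
  lin_subspace A -> A x -> A y -> A (x - y).
Proof.
move=> As Ax Ay; rewrite -scaleN1r; apply: lin_subspaceD => //.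
exact: lin_subspaceZ.
Qed.

Lemma lin_subspace_sum {V : lmodType R} (A : set V) (I : Type) (r : seq I)
    (P : pred I) (F : I -> V) :
  lin_subspace A -> (forall i, P i -> A (F i)) -> A (\sum_(i <- r | P i) F i).
Proof.
move=> As AF; elim/big_rec: _ => [|i x Pi Ax]; first by case/lin_subspaceP: As.
by apply: lin_subspaceD => //; exact: AF.
Qed.

Lemma lin_subspace_image {V W : lmodType R} (T : {linear V -> W}) (A : set V) :
  lin_subspace A -> lin_subspace (T @` A).
Proof.
move=> /lin_subspaceP[A0 AP]; apply/lin_subspaceP; split.
  by exists 0; rewrite ?linear0.
move=> a _ _ [x Ax <-] [y Ay <-]; exists (a *: x + y); last by rewrite linearP.
exact: AP.
Qed.

(** Strong induction on the length: a nontrivial relation expresses one vector by the others, and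
    that vector is dropped. *)
Lemma finite_span_has_dim {V : lmodType R} (s : seq V) :
  exists n, has_dim (lin_span [set` s]) n.
Proof.
have [n] := ubnP (size s); elim: n s => // n IHn s; rewrite ltnS => sn.
have [sI|] := pselect (lin_indep (in_tuple s)).
  by exists (size s), (in_tuple s).
move=> /existsNP[c /not_implyP[c0 /existsNP[i0 /eqP ci0]]].
(* Removal is by index, not by value, as [s] may have repetitions. *)
pose s' := [seq tnth (in_tuple s) i | i <- enum 'I_(size s) & i != i0].
have ss' : lin_span [set` s] = lin_span [set` s'].
  have s'P i : i != i0 -> lin_span [set` s'] (tnth (in_tuple s) i).
    move=> ii0; apply: sub_lin_span; apply/mapP; exists i => //.
    by rewrite mem_filter ii0 mem_enum.
  apply/seteqP; split; apply: lin_span_sub (lin_span_subspace _) _; last first.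
    move=> _ /mapP[i _ ->]; apply: sub_lin_span.
    exact: (mem_tnth i (in_tuple s)).
  move=> v /(nthP 0)[k ks <-]; pose i := Ordinal ks.
  rewrite -[nth _ _ _]/(nth 0 (in_tuple s) i) -tnth_nth.
  have [->{i}|] := eqVneq i i0; last exact: s'P.
  move: c0; rewrite (bigD1 i0)//= => /(congr1 (fun v => (c i0)^-1 *: v)).
  rewrite scaler0 scalerDr scalerA mulVf// scale1r => /eqP.
  rewrite addr_eq0 -scalerN => /eqP ->.
  apply: lin_subspaceZ (lin_span_subspace _) _; rewrite -sumrN.
  apply: lin_subspace_sum (lin_span_subspace _) _ => i ii0.
  rewrite -scaleNr; apply: lin_subspaceZ (lin_span_subspace _) _; exact: s'P.
rewrite ss'; apply: IHn; apply: leq_trans sn.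
rewrite size_map size_filter -[ltnRHS](size_enum_ord (size s)).
rewrite -[ltnRHS](count_predC (pred1 i0)) -[ltnLHS]add0n ltn_add2r.
by rewrite -has_count has_pred1 mem_enum.
Qed.

(** Induction on [s]: subtracting a multiple of the head [g] leaves a functional that vanishes on
    the common kernel of the tail. *)
Lemma mem_span_of_kernel {X : normedModType R} (S : set (dual_space X))
    (s : seq (dual_space X)) (f : dual_space X) :
  lin_subspace S -> {in s, forall g, S g} ->
  (forall x, {in s, forall g : dual_space X, g x = 0} -> f x = 0) -> S f.
Proof.
move=> Ss; elim: s f => [|g s IHs] f sS fs.
  have -> : f = 0 by apply/val_inj/funext => x; exact: fs.
  by case/lin_subspaceP: Ss.
have sS' : {in s, forall g, S g} by move=> h hs; apply: sS; rewrite inE hs orbT.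
have [gs|] := pselect (forall x,
    {in s, forall h : dual_space X, h x = 0} -> g x = 0).
  apply: IHs => // x sx; apply: fs => h; rewrite inE => /predU1P[->|].
    exact: gs.
  exact: sx.
move=> /existsNP[x0 /not_implyP[sx0 /eqP gx0]].
rewrite -(subrK ((f x0 / g x0) *: g) f); apply: lin_subspaceD => //; last first.
  by apply: lin_subspaceZ => //; apply: sS; rewrite mem_head.
apply: IHs => // x sx; rewrite dual_spaceB dual_spaceZ.
(* [x0] lies in the kernel of the tail and not in that of [g]; moving [x] along [x0] reaches the
   kernel of [g] as well. *)
have /fs : {in g :: s, forall h : dual_space X, h (x - (g x / g x0) *: x0) = 0}.
  move=> h; rewrite inE linearB /= dual_funZ => /predU1P[->|hs].
    by rewrite mulfVK// subrr.
  by rewrite (sx _ hs) (sx0 _ hs) mulr0 subr0.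
by rewrite linearB /= dual_funZ => <-; field.
Qed.

End subspaces.

(** * Construction of the vectors [h n] and of their test points *)

Section construction.
Context {R : realType} {X : normedModType R} {E : normedModType R}.
Variable T : {linear E -> dual_space X}.
Hypotheses (Einf : infinite_dimensional E) (Tinj : injective T).

(** Were every [T e] in the span of the images of [s], injectivity would make [s] span [E]; an [e]
    outside is separated by a point of the common kernel. *)
Lemma exists_annihilated (s : seq E) :
  exists (e : E) (x : X), {in s, forall h, T h x = 0} /\ T e x != 0.
Proof.
have [e eS] : exists e, ~ lin_span (T @` [set` s]) (T e).
  apply: contrapT => /forallNP sT; apply: Einf.
  have [n sn] := finite_span_has_dim s; exists n.
  rewrite (_ : [set: E] = lin_span [set` s])//; apply/seteqP; split=> // e _.
  have /contrapT : ~ ~ lin_span (T @` [set` s]) (T e) by exact: sT.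
  move=> /(@lin_span_sub _ _ _ (T @` lin_span [set` s]))[].
  - exact/lin_subspace_image/lin_span_subspace.
  - by apply: image_subset; exact: sub_lin_span.
  - by move=> e' se' /Tinj <-.
apply: contrapT => /forallNP/(_ e)/forallNP nx; apply: eS.
apply: (@mem_span_of_kernel _ _ _ (map T s)) (lin_span_subspace _) _ _.
  by move=> _ /mapP[h hs ->]; apply: sub_lin_span; exists h.
move=> x sx; apply/eqP/negPn/negP => ex0; apply: (nx x); split=> // h hs.
by apply: sx; apply/mapP; exists h.
Qed.

(** The vector [d] itself serves unless it vanishes at the separating point; in that case a vector
    of norm [eps] is added. *)
Lemma exists_perturbed (d : E) (eps : R) (s : seq E) : 0 < eps ->
  exists (e : E) (x : X),
    [/\ `|e - d| <= eps, {in s, forall h, T h x = 0} & T e x != 0].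
Proof.
move=> eps0; have [e [x [sx ex]]] := exists_annihilated s.
have [dx|dx] := eqVneq (T d x) 0; last first.
  by exists d, x; split=> //; rewrite subrr normr0 ltW.
have e0 : 0 < `|e|.
  rewrite normr_gt0; apply: contraNneq ex => ->.
  by rewrite linear0.
exists (d + (eps / `|e|) *: e), x; split=> //.
  rewrite addrC addKr normrZ gtr0_norm ?divr_gt0//.
  by rewrite mulfVK ?gt_eqF.
rewrite opD opZ dx add0r.
by rewrite mulf_neq0// gt_eqF// divr_gt0.
Qed.

(** The pairs [(h n, x n)] are chosen recursively: [x n] is killed by all earlier functionals, and
    [h n] is scaled down to be small at all earlier points. This gives the dominant diagonal that
    makes coefficients unique; scaling does not affect the approximation of the direction [d k]. *)
Lemma exists_triangular_system (d : nat -> E) :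
  exists (h : nat -> E) (x : nat -> X),
  [/\ forall n, `|h n| <= 2^-1 ^+ n,
      forall m, T (h m) (x m) != 0,
      forall n m, (n < m)%N -> T (h n) (x m) = 0,
      forall n m, (m < n)%N ->
        `|T (h n) (x m)| <= 2^-1 ^+ n.+2 * `|T (h m) (x m)|
    & forall k eps, 0 < eps -> exists n r, 0 < r /\
        `|h n - r *: d k| <= r * eps].
Proof.
(* Stage [n] decodes to a pair [(k, j)]: the direction [d k] within tolerance [1 / (j + 1)]. Every
   pair has its stage; the default merely fills the remaining ones, if any. *)
pose c n : nat * nat := odflt (0%N, 0%N) (unpickle n).
pose P (s : seq (E * X)) (a : E * X) := let n := size s in
  [/\ `|a.1| <= 2^-1 ^+ n, T a.1 a.2 != 0,
      {in s, forall b, T b.1 a.2 = 0},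
      (* The guard makes [P s] solvable for every list [s], not only for those that the recursion
         produces. *)
      {in s, forall b, T b.1 b.2 != 0 ->
        `|T a.1 b.2| <= 2^-1 ^+ n.+2 * `|T b.1 b.2|}
    & exists2 r, 0 < r & `|a.1 - r *: d (c n).1| <= r * (c n).2.+1%:R^-1].
have /seq_choice[u uP] : forall s, exists a, P s a.
  move=> s; set n := size s.
  have [] := @exists_perturbed (d (c n).1) (c n).2.+1%:R^-1 (map fst s).
    by rewrite invr_gt0.
  move=> e [x [de sx ex]].
  (* Demands on the scale [r]: norm at most [2^-1 ^+ n], and domination by the diagonal entry at
     each earlier point. *)
  pose cs := (2^-1 ^+ n, `|e|) ::
    [seq (2^-1 ^+ n.+2 * `|T b.1 b.2|, `|T e b.2|) | b <- s & T b.1 b.2 != 0].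
  have [|r r0 rP] := @small_scalar R cs.
    move=> a b; rewrite inE => /predU1P[[-> _]|/mapP[b']].
      by rewrite exprn_gt0.
    rewrite mem_filter => /andP[b'0 _] [-> _].
    by rewrite mulr_gt0 ?exprn_gt0 ?normr_gt0.
  exists (r *: e, x); split => /=.
  - rewrite normrZ gtr0_norm// ltW//; apply: rP.
    by rewrite mem_head.
  - by rewrite opZ mulf_neq0// gt_eqF.
  - by move=> b bs; apply: sx; exact: map_f.
  - move=> b bs b0; rewrite opZ normrM gtr0_norm//.
    rewrite ltW//; apply: rP; rewrite inE; apply/orP; right.
    by apply/mapP; exists b; rewrite ?mem_filter ?b0.
  - exists r => //; rewrite -scalerBr normrZ gtr0_norm//.
    by rewrite ler_pM2l.
have mem n m : (m < n)%N -> u m \in mkseq u n.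
  by move=> mn; apply: map_f; rewrite mem_iota.
exists (fst \o u), (snd \o u); split=> /=.
- by move=> n; have [] := uP n; rewrite size_mkseq.
- by move=> n; have [] := uP n.
- by move=> n m nm; have [_ _ + _ _] := uP m; apply; exact: mem.
- move=> n m mn; have [_ _ _ + _] := uP n; rewrite size_mkseq; apply.
    exact: mem.
  by have [] := uP m.
- move=> k eps eps0; have [j] : exists j, j.+1%:R^-1 <= eps.
    have [j _ /(_ j (leqnn j))] := near_infty_natSinv_lt (PosNum eps0).
    by move=> /= /ltW; exists j.
  move=> jeps; exists (pickle (k, j)).
  have [_ _ _ _ []] := uP (pickle (k, j)).
  rewrite size_mkseq /c pickleK/= => r r0 rd; exists r; split=> //.
  by rewrite (le_trans rd)// ler_pM2l.
Qed.

End construction.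

(** * Pointwise absolutely summable functionals and domination *)

Section absolute_sums.
Context {R : realType} {X : normedModType R}.
Implicit Types (w : nat -> dual_space X) (f : dual_space X).

Definition abs_summable w : Prop :=
  forall x, cvgn (series (fun n => `|w n x|)).

Definition absum w (x : X) : R := limn (series (fun n => `|w n x|)).

Lemma absumD w x y : abs_summable w -> absum w (x + y) <= absum w x + absum w y.
Proof.
move=> sw; rewrite /absum -lim_seriesD//; apply: lim_series_le => //.
  exact: is_cvg_seriesD.
by move=> n; rewrite linearD ler_normD.
Qed.

Lemma absumZ w a x : abs_summable w -> absum w (a *: x) = `|a| * absum w x.
Proof.
move=> sw; rewrite /absum -[RHS](lim_seriesZ _ (sw x)).
by congr (limn (series _)); apply/funext => n; rewrite dual_funZ normrM.
Qed.

Lemma absum_ge0 w x : abs_summable w -> 0 <= absum w x.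
Proof.
move=> sw; apply: limr_ge; first exact: sw.
by near=> n; apply: sumr_ge0.
Unshelve. all: by end_near. Qed.

Lemma cvg_abs_series_tail w x N : abs_summable w ->
  series (fun n => `|w (N + n)%N x|) @ \oo -->
    absum w x - \sum_(i < N) `|w i x|.
Proof.
move=> sw.
rewrite (_ : series _ = (fun n => series (fun n => `|w n x|) (n + N)%N -
  \sum_(i < N) `|w i x|)); last first.
  apply/funext => n; rewrite /series/= [(n + N)%N]addnC !big_mkord.
  by rewrite big_split_ord/= [RHS]addrC addKr.
apply: cvgB; last exact: cvg_cst.
by rewrite (cvg_shiftn N (series (fun n => `|w n x|))); exact: sw.
Qed.

Lemma abs_summable_tail w N : abs_summable w ->
  abs_summable (fun n => w (N + n)%N).
Proof. by move=> sw x; apply/cvg_ex; eexists; exact: cvg_abs_series_tail. Qed.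

Lemma absum_tail w N x : abs_summable w ->
  absum (fun n => w (N + n)%N) x = absum w x - \sum_(i < N) `|w i x|.
Proof. by move=> sw; apply/cvg_lim => //; exact: cvg_abs_series_tail. Qed.

(* The admissible coefficients form the interval between the sup of
   [f x - q x] over [w x = 1] and the inf of [q y - f y] over [w y = -1]. *)
Lemma split_dominated (q : X -> R) f (w : dual_space X) :
  (forall x y, q (x + y) <= q x + q y) ->
  (forall a x, q (a *: x) = `|a| * q x) ->
  (forall x, f x <= q x + `|w x|) ->
  exists a : R, `|a| <= 1 /\ forall x, f x - a * w x <= q x.
Proof.
move=> qD qZ fq.
(* The element [-1] keeps [A] nonempty when [w = 0] and gives the lower bound [-1 <= sup A]. *)
pose A := [set -1] `|` [set f x - q x | x in [set x | w x = 1]].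
have supA : has_sup A.
  split; first by exists (-1); left.
  exists 1 => _ [->|[x /= wx <-]]; first by lra.
  by rewrite lerBlDl (le_trans (fq x))// wx normr1.
have le_supA r : A r -> r <= sup A by exact: sup_upper_bound.
have supA_le r : (forall a, A a -> a <= r) -> sup A <= r.
  by move=> Ar; apply: ge_sup => //; case: supA.
have sup1 x : w x = 1 -> f x - q x <= sup A.
  by move=> wx; apply: le_supA; right; exists x.
have supN1 y : w y = -1 -> sup A <= q y - f y.
  move=> wy; apply: supA_le => _ [->|[x /= wx <-]].
    by rewrite lerBrDr addrC lerBlDr (le_trans (fq y))// wy normrN1.
  have := fq (x + y); rewrite !linearD/= wx wy subrr normr0 addr0 => fxy.
  by have := qD x y; lra.
exists (sup A); split.
  rewrite ler_norml; apply/andP; split; first by apply: le_supA; left.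
  apply: supA_le => _ [->|[x /= wx <-]]; first by lra.
  by rewrite lerBlDl (le_trans (fq x))// wx normr1.
(* Homogeneity reduces the two sign cases to [w x = 1] and [w x = -1]. *)
move=> x; have [wx|wx|wx] := ltgtP (w x) 0.
- have t0 : 0 < - w x by rewrite oppr_gt0.
  have := supN1 ((- w x)^-1 *: x); rewrite !dual_funZ qZ gtr0_norm ?invr_gt0//.
  rewrite -mulrBr -[X in _ * X = _]opprK mulrN mulVf ?gt_eqF// => /(_ erefl).
  by rewrite mulrC ler_pdivlMr// mulrN; lra.
- have := sup1 ((w x)^-1 *: x); rewrite !dual_funZ qZ gtr0_norm ?invr_gt0//.
  rewrite mulVf ?gt_eqF// -mulrBr => /(_ erefl).
  by rewrite mulrC ler_pdivrMr//; lra.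
- by have := fq x; rewrite wx normr0 mulr0; lra.
Qed.

(** Iterates [split_dominated] with [q] the norm plus the absolute sum of the terms still to
    come. *)
Lemma split_dominated_series w f : abs_summable w ->
  (forall x, f x <= `|x| + absum w x) ->
  exists a : nat -> R, (forall n, `|a n| <= 1) /\
    forall N x, f x - \sum_(i < N) a i * w i x <=
      `|x| + (absum w x - \sum_(i < N) `|w i x|).
Proof.
move=> sw fw.
pose g (s : seq R) : dual_space X := f - \sum_(i < size s) s`_i *: w i.
have gE s x : g s x = f x - \sum_(i < size s) s`_i * w i x.
  by rewrite /g dual_spaceB (dual_space_sum _ _ _ (fun i => s`_i *: w i)).
pose D (s : seq R) := forall x, g s x <=
  `|x| + absum (fun n => w (size s + n)%N) x.
(* Conditional on [D s], so that a choice exists for every list; [0] serves where [D s] fails. *)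
pose P s (a : R) := `|a| <= 1 /\ (D s -> D (rcons s a)).
have gS s a x : g (rcons s a) x = g s x - a * w (size s) x.
  rewrite !gE size_rcons big_ord_recr/= nth_rcons ltnn eqxx opprD addrA.
  congr (_ - _ - _); apply: eq_bigr => i _.
  by rewrite nth_rcons ltn_ord.
have /seq_choice[a aP] : forall s, exists a, P s a.
  move=> s; have [Ds|nD] := pselect (D s); last first.
    by exists 0; split=> [|//]; rewrite normr0.
  have st := abs_summable_tail w (size s).+1 sw.
  have [||x|a [a1 aP]] := @split_dominated
      (fun x => `|x| + absum (fun n => w ((size s).+1 + n)%N) x)
      (g s) (w (size s)).
  - move=> x y; rewrite addrACA lerD ?ler_normD//.
    exact: absumD.
  - by move=> a x; rewrite absumZ// mulrDr normrZ.
  - apply: (le_trans (Ds x)); rewrite -addrA lerD2l !absum_tail//.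
    by rewrite big_ord_recr/=; lra.
  - by exists a; split=> // _ x; rewrite gS size_rcons; exact: aP.
exists a; split=> [n|N x]; first by have [] := aP n.
have : D (mkseq a N).
  elim: N => [|N IHN]; last by rewrite mkseqS; have [_] := aP N; apply.
  by move=> y; rewrite gE big_ord0 subr0; exact: fw.
move=> /(_ x); rewrite gE size_mkseq absum_tail//.
congr (_ - _ <= _); apply: eq_bigr => i _.
by rewrite nth_mkseq.
Qed.

(** The tail in the bound tends to 0, which gives the domination by the norm. At [z] the bound for
    [f] is an equality, so every inequality [a n * w n z <= |w n z|] must be one too. *)
Lemma split_dominated_limit w (f g : dual_space X) (a : nat -> R) z :
  abs_summable w -> (forall n, `|a n| <= 1) ->
  (forall N x, f x - \sum_(i < N) a i * w i x <=
      `|x| + (absum w x - \sum_(i < N) `|w i x|)) ->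
  (forall x, (fun N => \sum_(i < N) a i * w i x) @ \oo --> g x) ->
  f z = `|z| + absum w z ->
  [/\ forall x, f x - g x <= `|x|, f z - g z = `|z|
    & forall n, a n * w n z = `|w n z| ].
Proof.
move=> sw a1 fw ag fz.
have cvS x : (fun N => \sum_(i < N) `|w i x|) @ \oo --> absum w x.
  rewrite (_ : (fun N => _) = series (fun n => `|w n x|)); first exact: sw.
  by apply/funext => N; rewrite /series/= big_mkord.
have awz n : a n * w n z = `|w n z|.
  have le i : a i * w i z <= `|w i z|.
    by rewrite (le_trans (ler_norm _))// normrM ler_piMl.
  apply/eqP; rewrite eq_le le/= -subr_le0.
  (* At stage [n.+1] the norm and the absolute sum cancel, leaving the reverse inequality between
     the two partial sums. *)
  have := fw n.+1 z; rewrite fz !big_ord_recr/=.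
  have : \sum_(i < n) a i * w i z <= \sum_(i < n) `|w i z| by exact: ler_sum.
  by lra.
split=> // [x|].
  have lhs : (fun N => f x - \sum_(i < N) a i * w i x) @ \oo --> f x - g x.
    by apply: cvgB; [exact: cvg_cst|exact: ag].
  have rhs : (fun N => `|x| + (absum w x - \sum_(i < N) `|w i x|)) @ \oo -->
      `|x| + (absum w x - absum w x).
    by apply: cvgD; [exact: cvg_cst|apply: cvgB; [exact: cvg_cst|exact: cvS]].
  rewrite -[leRHS]addr0 -(subrr (absum w x)) -(cvg_lim _ lhs)//.
  rewrite -(cvg_lim _ rhs)//.
  apply: ler_lim; [exact: cvgP lhs|exact: cvgP rhs|].
  by near=> N; exact: fw.
have -> : g z = absum w z.
  apply: cvg_unique (ag z) _ => //.
  rewrite (_ : (fun N => _) = fun N => \sum_(i < N) `|w i z|); first exact: cvS.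
  by apply/funext => N; apply: eq_bigr => i _; rewrite awz.
by rewrite fz addrK.
Unshelve. all: by end_near. Qed.

End absolute_sums.

(** * Functionals that are nonzero at given points *)

(** A multiple [t *: w] mends a zero at the new point; [t] is so small that it cannot cancel [y] at
    the old ones. *)
Lemma exists_nonvanishing (R : realType) (X : normedModType R)
    (S : set (dual_space X)) (zs : seq X) : lin_subspace S ->
  (forall z, z \in zs -> exists2 w, S w & w z != 0) ->
  exists2 y, S y & forall z, z \in zs -> y z != 0.
Proof.
move=> Ss; elim: zs => [_|z zs IHzs zsS].
  by exists 0 => //; case/lin_subspaceP: Ss.
have [|y Sy yzs] := IHzs.
  by move=> z' z's; apply: zsS; rewrite inE z's orbT.
have [yz0|yz0] := eqVneq (y z) 0; last first.
  by exists y => // z'; rewrite inE => /predU1P[->|] //; exact: yzs.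
have [w Sw wz] := zsS z (mem_head _ _).
have [|t t0 tP] := @small_scalar R [seq (`|y z'|, `|w z'|) | z' <- zs].
  by move=> _ _ /mapP[z' z's [-> _]]; rewrite normr_gt0 yzs.
exists (t *: w + y).
  by apply: lin_subspaceD => //; exact: lin_subspaceZ.
move=> z'; rewrite inE dual_spaceD dual_spaceZ => /predU1P[->|z's].
  by rewrite yz0 addr0 mulf_neq0// gt_eqF.
have : t * `|w z'| < `|y z'| by apply: tP; apply/mapP; exists z'.
rewrite -{1}(gtr0_norm t0) -normrM; apply: contraTneq => /eqP.
by rewrite addr_eq0 => /eqP ->; rewrite normrN ltxx.
Qed.

(** Evaluation at [z] is weak-star continuous, so the functionals nonzero at [z] form a weak-star
    open set, nonempty because of [f]. *)
Lemma weak_star_dense_separates (R : realType) (X : normedModType R)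
    (Y : set (dual_space X)) (f : dual_space X) z :
  dense (Y : set (weak_star X)) -> f z != 0 -> exists2 y, Y y & y z != 0.
Proof.
move=> dY fz.
have cz : continuous (fun g : weak_star X => (g : dual_space X) z : R).
  move=> g; apply: (@continuous_comp (weak_star X) {ptws X -> R} R
    (fun g => (g : dual_space X) : {ptws X -> R}) (proj z)).
    exact: initial_continuous.
  exact: proj_continuous.
have [|//|g [/= gz Yg]] := dY [set g | (g : dual_space X) z != 0].
- by exists f.
- have := open_comp _ (@open_neq R 0).
  move=> /(_ _ (fun g : weak_star X => (g : dual_space X) z : R)).
  by apply => g _; exact: cz.
- by exists g.
Qed.

(** * The dual norm of an equivalent norm *)

Section equivalent_norms.
Context {R : realType} {X : normedModType R} (p : X -> R).
Hypothesis ep : equivalent_norm p.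

Lemma equivalent_norm_ge0 x : 0 <= p x.
Proof.
have [_ [c [C [c0 _ /(_ x)/andP[cp _]]]]] := ep.
by rewrite (le_trans _ cp)// mulr_ge0// ltW.
Qed.

Lemma equivalent_norm_gt0 x : x != 0 -> 0 < p x.
Proof.
move=> x0; rewrite lt_neqAle equivalent_norm_ge0 andbT eq_sym.
by apply: contraNneq x0; have [[_ _ p0] _] := ep => /p0 ->.
Qed.

Lemma equivalent_norm0 : p 0 = 0.
Proof.
by have [[_ pZ _] _] := ep; rewrite -(scale0r (0 : X)) pZ normr0 mul0r.
Qed.

Lemma equivalent_dual_norm_has_sup (f : dual_space X) :
  has_sup [set `|f x| | x in [set x | p x <= 1]].
Proof.
split; first by exists `|f 0|; exists 0 => //=; rewrite equivalent_norm0.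
have [_ [c [C [c0 _ cp]]]] := ep.
exists (dual_norm Num.norm f * c^-1) => _ [x /= px <-].
rewrite (le_trans (le_dual_norm _ _))// ler_wpM2l ?dual_norm_ge0//.
rewrite -[leRHS]mul1r ler_pdivlMr// mulrC.
by have /andP[cx _] := cp x; rewrite (le_trans cx).
Qed.

Lemma le_equivalent_dual_norm (f : dual_space X) x :
  `|f x| <= dual_norm p f * p x.
Proof.
have [->|x0] := eqVneq x 0.
  by rewrite linear0 normr0 equivalent_norm0 mulr0.
have [[_ pZ _] _] := ep; have px := equivalent_norm_gt0 _ x0.
have -> : f x = f ((p x)^-1 *: x) * p x.
  by rewrite dual_funZ mulrC mulVKf ?gt_eqF.
rewrite normrM [`|p x|]gtr0_norm// ler_pM2r//.
apply: (sup_upper_bound (equivalent_dual_norm_has_sup f)).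
exists ((p x)^-1 *: x) => //=.
by rewrite pZ gtr0_norm ?invr_gt0// mulVf ?gt_eqF.
Qed.

Lemma equivalent_dual_norm_ge0 (f : dual_space X) : 0 <= dual_norm p f.
Proof.
apply: (sup_upper_bound (equivalent_dual_norm_has_sup f)).
by exists 0 => /=; rewrite ?linear0 ?normr0// equivalent_norm0.
Qed.

Lemma equivalent_dual_norm_gt0 (f : dual_space X) : f != 0 -> 0 < dual_norm p f.
Proof.
move=> f0; rewrite lt_neqAle equivalent_dual_norm_ge0 andbT eq_sym.
apply: contraNneq f0 => pf0; apply/eqP/val_inj/funext => x; apply/eqP.
by rewrite -normr_le0 (le_trans (le_equivalent_dual_norm f x))// pf0 mul0r.
Qed.

Lemma equivalent_dual_normZ a (f : dual_space X) :
  dual_norm p (a *: f) = `|a| * dual_norm p f.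
Proof.
have le b (g : dual_space X) : dual_norm p (b *: g) <= `|b| * dual_norm p g.
  apply: ge_sup; first by case: (equivalent_dual_norm_has_sup (b *: g)).
  move=> _ [x px <-]; rewrite dual_spaceZ normrM ler_wpM2l//.
  rewrite (le_trans (le_equivalent_dual_norm g x))//.
  by rewrite ler_piMr// equivalent_dual_norm_ge0.
apply/eqP; rewrite eq_le le/=; have [->|a0] := eqVneq a 0.
  by rewrite normr0 mul0r equivalent_dual_norm_ge0.
rewrite -[in leLHS](scalerK a0 f) (le_trans (ler_wpM2l _ (le _ _)))//.
by rewrite normfV mulVKf ?normr_eq0.
Qed.

Lemma NA_scale a (f : dual_space X) : NA p f -> NA p (a *: f).
Proof.
move=> [x px fx]; exists x => //.
by rewrite equivalent_dual_normZ dual_spaceZ normrM fx.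
Qed.

Lemma equivalent_dual_norm_unit (f : dual_space X) : f != 0 ->
  dual_norm p ((dual_norm p f)^-1 *: f) = 1.
Proof.
move=> /equivalent_dual_norm_gt0 pf.
by rewrite equivalent_dual_normZ gtr0_norm ?invr_gt0// mulVf ?gt_eqF.
Qed.

End equivalent_norms.

(** * Uniqueness of bounded coefficients *)

(** Bounds the total weight of the off-diagonal terms relative to the diagonal one. *)
Lemma sum_half_powers_le (R : realType) k :
  \sum_(i < k) 2^-1 ^+ i.+2 <= 2^-1 :> R.
Proof.
suff -> : \sum_(i < k) 2^-1 ^+ i.+2 = 2^-1 - 2^-1 ^+ k.+1 :> R.
  by rewrite gerBl exprn_ge0.
elim: k => [|k IHk]; first by rewrite big_ord0 expr1 subrr.
by rewrite big_ord_recr/= IHk !exprS; lra.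
Qed.

(* The m-th series, whose terms before the m-th vanish, bounds [|b m|] by half
   of any bound of [b]. *)
Lemma coefficients_unique (R : realType) (c : nat -> nat -> R) (b : nat -> R)
    (B : R) :
  (forall m, c m m != 0) -> (forall n m, (n < m)%N -> c n m = 0) ->
  (forall n m, (m < n)%N -> `|c n m| <= 2^-1 ^+ n.+2 * `|c m m|) ->
  (forall n, `|b n| <= B) ->
  (forall m, (fun N => \sum_(i < N) b i * c i m) @ \oo --> 0) ->
  forall n, b n = 0.
Proof.
move=> c_diag c_low c_up bB bc.
have step (B' : R) : (forall n, `|b n| <= B') -> forall m, `|b m| <= B' / 2.
  move=> bB' m; have B'0 : 0 <= B' by rewrite (le_trans _ (bB' 0%N)).
  have cm0 : 0 < `|c m m| by rewrite normr_gt0.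
  rewrite -(ler_pM2r cm0) -normrM.
  have lim0 : (fun k => `|\sum_(i < k + m.+1) b i * c i m| +
      B' / 2 * `|c m m|) @ \oo --> `|0 : R| + B' / 2 * `|c m m|.
    apply: cvgD; last exact: cvg_cst.
    apply: cvg_norm; have := bc m.
    by rewrite -(cvg_shiftn m.+1); exact.
  rewrite -[leRHS]add0r -[X in X + _](normr0 R) -(cvg_lim _ lim0)//.
  apply: limr_ge; first exact: cvgP lim0.
  (* Terms before the [m]-th vanish, the [m]-th is [b m * c m m], and the rest [t] is at most half
     of [B' * |c m m|]. *)
  near=> k; rewrite [(k + _)%N]addnC big_split_ord/= big_ord_recr/=.
  rewrite big1 ?add0r => [|i _]; last by rewrite c_low ?mulr0.
  set t := \sum_(i < k) _.
  have tB : `|t| <= B' / 2 * `|c m m|.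
    rewrite (le_trans (ler_norm_sum _ _ _))//.
    rewrite (@le_trans _ _ (\sum_(i < k) B' * `|c m m| * 2^-1 ^+ i.+2))//.
      apply: ler_sum => i _; rewrite normrM -mulrA ler_pM//.
      rewrite (le_trans (c_up _ _ _)) ?ltn_addr// mulrC ler_wpM2l//.
      by apply: ler_wiXn2l; [rewrite invr_ge0|lra|exact: leq_addl].
    rewrite -mulr_sumr [leRHS]mulrAC ler_wpM2l ?mulr_ge0//.
    exact: sum_half_powers_le.
  rewrite -lerBlDr (le_trans _ (lerB_normD _ _))//; by lra.
(* The least bound [s] is at most half of itself, hence at most 0. *)
pose s := sup (range (fun n => `|b n|)).
have sb : has_sup (range (fun n => `|b n|)).
  by split; [exists `|b 0%N|, 0%N|exists B => _ [n _ <-]].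
have bs n : `|b n| <= s by apply: sup_upper_bound => //; exists n.
have s0 : s <= s / 2.
  by apply: ge_sup => [|_ [n _ <-]]; [case: sb|exact: step].
by move=> n; apply/eqP; rewrite -normr_le0 (le_trans (bs n))//; lra.
Unshelve. all: by end_near. Qed.

(** * The perturbed norm and its norm-attaining functionals *)

Section renorming.
Context {R : realType} {X : normedModType R} {E : completeNormedModType R}.
Variables (T : {linear E -> dual_space X}) (M : R) (h : nat -> E).
Hypotheses (M0 : 0 < M) (TM : forall e, `|T e| <= M * `|e|).
Hypothesis h_small : forall n, `|h n| <= 2^-1 ^+ n.

Lemma op_le e x : `|T e x| <= M * `|x| * `|e|.
Proof.
rewrite (le_trans (le_dual_norm _ _))// mulrAC ler_wpM2r//; exact: TM.
Qed.

Lemma half_lt1 : `|2^-1 : R| < 1.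
Proof. by rewrite ger0_norm// invf_lt1 ?ltr1n. Qed.

Lemma op_le_geometric n x : `|T (h n) x| <= geometric (M * `|x|) 2^-1 n.
Proof.
by rewrite (le_trans (op_le _ _))//= ler_wpM2l// mulr_ge0// ltW.
Qed.

Lemma abs_summable_op : abs_summable (T \o h).
Proof.
move=> x.
apply: series_le_cvg (is_cvg_geometric_series (a := M * `|x|) half_lt1) => //.
- by move=> n; apply: geometric_ge0 => //; rewrite mulr_ge0// ltW.
- by move=> n; exact: op_le_geometric.
Qed.

Lemma absum_op_le x : absum (T \o h) x <= M * 2 * `|x|.
Proof.
have gs := is_cvg_geometric_series half_lt1.
have le_lim := lim_series_le (abs_summable_op x) (gs _) (op_le_geometric^~ x).
rewrite (le_trans le_lim)//.
rewrite (cvg_lim _ (cvg_geometric_series half_lt1))//.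
rewrite (_ : 1 - 2^-1 = 2^-1 :> R); last by lra.
by rewrite invrK mulrAC.
Qed.

(** Completeness of [E] sums the absolutely convergent series of the [a n *: h n], and boundedness
    of [T] carries the limit to each point [x]. *)
Lemma exists_op_series (a : nat -> R) : (forall n, `|a n| <= 1) ->
  exists g : E, forall x,
    (fun N => \sum_(i < N) a i * T (h i) x) @ \oo --> T g x.
Proof.
move=> a1.
have ca : cvgn (series (fun n => a n *: h n)).
  apply: normed_cvg.
  apply: series_le_cvg (is_cvg_geometric_series (a := 1) half_lt1) => //=.
  by move=> n; rewrite normrZ ler_pM.
exists (limn (series (fun n => a n *: h n))) => x.
set g := limn _.
(* The [+ 1] keeps the factor positive at [x = 0]. *)
have Mx0 : 0 < M * `|x| + 1 by rewrite ltr_wpDl// mulr_ge0// ltW.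
apply/cvgrPdist_le => /= e e0; near=> N.
rewrite (_ : \sum_(i < N) _ = T (series (fun n => a n *: h n) N) x); last first.
  rewrite /series/= big_mkord (op_sum _ _ (fun i => a i *: h i)).
  by apply: eq_bigr => i _; rewrite opZ.
rewrite -opB (le_trans (op_le _ _))//.
rewrite (@le_trans _ _
  ((M * `|x| + 1) * `|g - series (fun n => a n *: h n) N|))//.
  by rewrite ler_wpM2r// lerDl.
rewrite -ler_pdivlMl//; near: N; apply: cvgr_dist_le => //.
by rewrite mulr_gt0// invr_gt0.
Unshelve. all: by end_near. Qed.

Definition perturbed_norm (x : X) : R := `|x| + absum (T \o h) x.

Lemma perturbed_norm_equivalent : equivalent_norm perturbed_norm.
Proof.
have sT := abs_summable_op; split; first split.
- by move=> x y; rewrite addrACA lerD ?ler_normD//; exact: absumD.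
- by move=> a x; rewrite /perturbed_norm absumZ// normrZ mulrDr.
- move=> x /eqP; rewrite paddr_eq0//; last exact: absum_ge0.
  by rewrite normr_eq0 => /andP[/eqP].
exists 1, (1 + M * 2); split=> // [|x].
  by rewrite addr_gt0// mulr_gt0.
by rewrite mul1r mulrDl mul1r lerDl absum_ge0// lerD2l absum_op_le.
Qed.

(** Splitting off the [T (h n)] one by one and passing to the limit leaves a functional that attains
    its norm in the direction of [z]. The clause [f z != 0] lets weak-star density later find
    elements of the range of [T] nonzero at [z]. *)
Lemma NA_decomposition (f : dual_space X) :
  NA perturbed_norm f -> dual_norm perturbed_norm f = 1 ->
  exists (g : E) (a : nat -> R) (z : X),
    [/\ NA Num.norm (f - T g), f z != 0, forall n, `|a n| <= 1,
        forall x, (fun N => \sum_(i < N) a i * T (h i) x) @ \oo --> T g x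
      & forall n, T (h n) z != 0 -> `|a n| = 1].
Proof.
have ep := perturbed_norm_equivalent.
move=> [x px fx] f1; rewrite f1 in fx.
have sT := abs_summable_op.
have [a [a1 fa]] : exists a : nat -> R, (forall n, `|a n| <= 1) /\
    forall N x, f x - \sum_(i < N) a i * T (h i) x <=
      `|x| + (absum (T \o h) x - \sum_(i < N) `|T (h i) x|).
  apply: (split_dominated_series _ _ sT) => y.
  rewrite (le_trans (ler_norm _))//.
  rewrite (le_trans (le_equivalent_dual_norm _ ep f y))//.
  by rewrite f1 mul1r.
have [g ag] := exists_op_series a a1.
(* As [f x] is 1 or -1, this fixes the sign: [f z = 1]. *)
pose z := f x *: x.
have fz : f z = 1.
  by rewrite dual_funZ -expr2 -real_normK ?num_real// -fx expr1n.
have pz : perturbed_norm z = 1.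
  by have [[_ -> _] _] := ep; rewrite -fx px mulr1.
have [|ule uz az] := split_dominated_limit _ _ _ _ z sT a1 fa ag.
  by rewrite fz -pz.
exists g, a, z; split=> //.
- have z0 : 0 < `|z|.
    rewrite normr_gt0; apply/eqP => z0; move: fz.
    by rewrite z0 linear0 => /esym/eqP; rewrite oner_eq0.
  (* The one-sided bound at [y] and at [- y] gives the two-sided one. *)
  have u1 : dual_norm Num.norm (f - T g) <= 1.
    have ule' y : (f - T g) y <= `|y| by exact: ule.
    apply: dual_norm_le => // y; rewrite mul1r ler_norml ule' andbT lerNl.
    by have := ule' (- y); rewrite normrN linearN.
  have uz1 : `|(f - T g) (`|z|^-1 *: z)| = 1.
    rewrite dual_funZ dual_spaceB uz mulVf ?gt_eqF// normr1 //.
  have nz1 : `|(`|z|^-1 *: z)| = 1.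
    by rewrite normrZ normfV normr_id mulVf ?gt_eqF.
  exists (`|z|^-1 *: z) => //; rewrite uz1.
  apply/eqP; rewrite eq_le u1 /= -[leLHS]uz1.
  by rewrite (le_trans (le_dual_norm _ _))// nz1 mulr1.
- by rewrite fz oner_eq0.
- move=> n hz; apply: (mulIf (x := `|T (h n) z|)); first by rewrite normr_eq0.
  by rewrite mul1r -normrM az normr_id.
Qed.

End renorming.

(** * Density of directions and reduction to pairs of functionals *)

Lemma separable_range_enum (R : realType) (V W : normedModType R) (T : V -> W) :
  separable_set (range T) ->
  exists d : nat -> V,
    forall v (eps : R), 0 < eps -> exists k, `|T (d k) - T v| < eps.
Proof.
move=> [D [/pcard_surjP[g Dg] DT TD]].
(* The enumeration [g] may leave [D]; there the default [d n = 0] is harmless. *)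
have /choice[d dP] : forall n, exists v, D (g n) -> T v = g n.
  move=> n; have [/DT[v _ vg]|nD] := pselect (D (g n)); first by exists v.
  by exists 0.
exists d => v eps eps0.
have Tv : range T (T v) by exists v.
have [w [Dw]] := TD _ Tv (ball (T v) eps) (nbhsx_ballx (T v) _ eps0).
rewrite -ball_normE/= distrC => vw; have [k _ gk] := Dg _ Dw.
by exists k; rewrite dP gk.
Qed.

Lemma lin_indep_pair (R : realType) (V : lmodType R) (u v : V) :
  lin_indep [tuple u; v] <->
  forall a b : R, a *: u + b *: v = 0 -> a = 0 /\ b = 0.
Proof.
have sumE (c : 'I_2 -> R) : \sum_(i < 2) c i *: tnth [tuple u; v] i =
    c ord0 *: u + c ord_max *: v.
  rewrite !big_ord_recl big_ord0 addr0 !(tnth_nth 0)/=.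
  by congr (_ + c _ *: _); exact: val_inj.
split=> [uv a b ab|uv c].
  pose c (i : 'I_2) := if i == ord0 then a else b.
  have /uv c0 : \sum_(i < 2) c i *: tnth [tuple u; v] i = 0 by rewrite sumE.
  by split; [exact: (c0 ord0)|exact: (c0 ord_max)].
rewrite sumE => /uv[c0 c1] i; have [->//|i0] := eqVneq i ord0.
by rewrite (_ : i = ord_max)//; apply/val_inj; case: i i0 => -[|[]].
Qed.

(** One [T v] is nonzero at all the points; [T (h n)], up to the factor [r], is close enough to it
    to be nonzero there as well. *)
Lemma exists_common_nonvanishing (R : realType) (X E : normedModType R)
    (T : {linear E -> dual_space X}) (M : R) (d h : nat -> E) (zs : seq X) :
  0 < M -> (forall e, `|T e| <= M * `|e|) ->
  (forall v (eps : R), 0 < eps -> exists k, `|T (d k) - T v| < eps) ->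
  (forall k (eps : R), 0 < eps -> exists n r, 0 < r /\
    `|h n - r *: d k| <= r * eps) ->
  (forall z, z \in zs -> exists2 w, range T w & w z != 0) ->
  exists n, forall z, z \in zs -> T (h n) z != 0.
Proof.
move=> M0 TM dT hd zsT.
have Ts : lin_subspace (range T).
  apply: lin_subspace_image; exact/lin_subspaceP.
have [_ [v _ <-] vzs] := exists_nonvanishing _ _ _ _ Ts zsT.
(* The factor 2 leaves room for two errors: [T (d k)] against [T v], and [h n] against
   [r *: d k]. *)
have [|eps eps0 epsP] := @small_scalar R [seq (`|T v z|, 2 * `|z|) | z <- zs].
  by move=> _ _ /mapP[z zzs [-> _]]; rewrite normr_gt0 vzs.
have [k kP] := dT v eps eps0.
have [|n [r [r0 nP]]] := hd k (eps / M); first by rewrite divr_gt0.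
exists n => z zzs.
have lt_eps : eps * (2 * `|z|) < `|T v z| by apply: epsP; apply/mapP; exists z.
have close1 : `|T (h n) z - r * T (d k) z| <= r * eps * `|z|.
  rewrite -opZ -opB (le_trans (le_dual_norm _ _))// ler_wpM2r//.
  rewrite (le_trans (TM _))// (le_trans (ler_wpM2l (ltW M0) nP))//.
  by rewrite mulrCA [M * _]mulrC mulfVK ?gt_eqF.
have close2 : `|r * T (d k) z - r * T v z| <= r * eps * `|z|.
  rewrite -mulrBr normrM gtr0_norm// -mulrA ler_pM2l// -dual_spaceB.
  by rewrite (le_trans (le_dual_norm _ _))// ler_wpM2r// ltW.
apply: contraTneq lt_eps => hz; rewrite -leNgt -(ler_pM2l r0).
move: close1; rewrite hz sub0r normrN => close1.
rewrite -[X in X * `|T v z|]gtr0_norm// -normrM.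
rewrite -[r * T v z](subrK (r * T (d k) z)) addrC.
rewrite (le_trans (ler_normD _ _))// [X in _ + X <= _]distrC.
by rewrite (le_trans (lerD close1 close2))//; lra.
Qed.

(** A plane inside [NA p] would contain, with a basis scaled to dual norm 1, also its sum and
    difference. *)
Lemma Read_norm_of_pairs (R : realType) (X : normedModType R) (p : X -> R) :
  equivalent_norm p ->
  (forall f1 f2 : dual_space X, lin_indep [tuple f1; f2] ->
    NA p f1 -> NA p f2 -> dual_norm p f1 = 1 -> dual_norm p f2 = 1 ->
    ~ NA p (f1 + f2) \/ ~ NA p (f1 - f2)) ->
  Read_norm p.
Proof.
move=> ep pairs; split=> // -[S [b bI SE] SNA].
have Ss : lin_subspace S by rewrite SE; exact: lin_span_subspace.
pose f1 := tnth b ord0; pose f2 := tnth b ord_max.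
have Sb i : S (tnth b i) by rewrite SE; apply: sub_lin_span; exact: mem_tnth.
have bE : b = [tuple f1; f2].
  apply/val_inj; rewrite /f1 /f2 /= !(tnth_nth 0).
  by case: (b) => -[|u [|v [|? ?]]].
move: bI; rewrite bE => /lin_indep_pair b12.
have f10 : f1 != 0.
  apply/eqP => f10; have [|/eqP] := b12 1 0; rewrite ?oner_eq0//.
  by rewrite f10 scaler0 scale0r addr0.
have f20 : f2 != 0.
  apply/eqP => f20; have [|_ /eqP] := b12 0 1; rewrite ?oner_eq0//.
  by rewrite f20 scaler0 scale0r addr0.
pose r1 := dual_norm p f1; pose r2 := dual_norm p f2.
have r10 : r1^-1 != 0 by rewrite invr_eq0 gt_eqF// equivalent_dual_norm_gt0.
have r20 : r2^-1 != 0 by rewrite invr_eq0 gt_eqF// equivalent_dual_norm_gt0.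
have S1 : S (r1^-1 *: f1) by apply: lin_subspaceZ => //; exact: Sb.
have S2 : S (r2^-1 *: f2) by apply: lin_subspaceZ => //; exact: Sb.
have [||||||] := pairs (r1^-1 *: f1) (r2^-1 *: f2).
- apply/lin_indep_pair => a c; rewrite !scalerA => /b12[/eqP + /eqP].
  rewrite !mulf_eq0 (negbTE r10) (negbTE r20) !orbF.
  by move=> /eqP -> /eqP ->.
- exact: SNA.
- exact: SNA.
- exact: equivalent_dual_norm_unit.
- exact: equivalent_dual_norm_unit.
- by apply; apply: SNA; exact: lin_subspaceD.
- by apply; apply: SNA; exact: lin_subspaceB.
Qed.

(** * Existence of the Read norm *)

Theorem theorem3p1 (R : realType) (X : completeNormedModType R)
    (modest_NA : weak_star_modest (lin_span (NA (@Num.norm R X)))) :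
  exists p : X -> R, Read_norm p /\
    forall x z : dual_space X, lin_indep [tuple x; z] ->
      NA p x -> NA p z -> dual_norm p x = 1 -> dual_norm p z = 1 ->
      ~ NA p (x + z) \/ ~ NA p (x - z).
Proof.
have [spanNA [Y [[_ [E [T [Einf Tbd Tinj TY]]]] Ysep Ydense NAY]]] := modest_NA.
rewrite -{Y}TY in Ysep Ydense NAY.
have [M M0 TM] : exists2 M : R, 0 < M & forall e, `|T e| <= M * `|e|.
  by have /linear_boundedP/pinfty_ex_gt0[M M0 TM] := Tbd; exists M.
have [d dT] := separable_range_enum _ _ _ _ Ysep.
have [h [x [h_small c_diag c_low c_up hd]]] :=
  exists_triangular_system T Einf Tinj d.
pose p := perturbed_norm T h.
have ep : equivalent_norm p := perturbed_norm_equivalent T M h M0 TM h_small.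
have no_pair (f1 f2 : dual_space X) : lin_indep [tuple f1; f2] ->
    NA p f1 -> NA p f2 -> dual_norm p f1 = 1 -> dual_norm p f2 = 1 ->
    NA p (f1 + f2) -> NA p (f1 - f2) -> False.
  move=> f12 NAf1 NAf2 pf1 pf2 NAD NAB.
  move/lin_indep_pair: f12 => comb0.
  (* Being nonzero, [f1 + f2] and [f1 - f2] can be scaled to dual norm 1 and decomposed as well. *)
  have D0 : f1 + f2 != 0.
    apply/eqP => D0; have [|/eqP] := comb0 1 1; first by rewrite !scale1r.
    by rewrite oner_eq0.
  have B0 : f1 - f2 != 0.
    apply/eqP => B0; have [|/eqP] := comb0 1 (-1).
      by rewrite scale1r scaleN1r.
    by rewrite oner_eq0.
  pose al := dual_norm p (f1 + f2); pose be := dual_norm p (f1 - f2).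
  have al0 : 0 < al by exact: equivalent_dual_norm_gt0.
  have be0 : 0 < be by exact: equivalent_dual_norm_gt0.
  have dec := NA_decomposition T M h M0 TM h_small.
  have [g1 [a1 [z1 [u1 fz1 le1 s1 e1]]]] := dec _ NAf1 pf1.
  have [g2 [a2 [z2 [u2 fz2 le2 s2 e2]]]] := dec _ NAf2 pf2.
  have [g3 [a3 [z3 [u3 fz3 le3 s3 e3]]]] := dec _ (NA_scale _ ep al^-1 _ NAD)
    (equivalent_dual_norm_unit _ ep _ D0).
  have [g4 [a4 [z4 [u4 fz4 le4 s4 e4]]]] := dec _ (NA_scale _ ep be^-1 _ NAB)
    (equivalent_dual_norm_unit _ ep _ B0).
  (* Used with [s = 1], [t = al] and with [s = -1], [t = be]: a linear relation among the
     functionals passes to their coefficients. *)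
  have key (s t : R) f (g : E) (a : nat -> R) : 0 < t ->
      f1 + s *: f2 = t *: f -> NA Num.norm (f - T g) ->
      (forall n, `|a n| <= 1) ->
      (forall x, (fun N => \sum_(i < N) a i * T (h i) x) @ \oo --> T g x) ->
      forall n, a1 n + s * a2 n = t * a n.
    move=> t0 ff u le sg n.
    (* This functional is in the range of [T] and, as a combination of the norm-attaining parts, in
       the span of NA(X); the two meet only in 0. *)
    have Tg0 : T (g1 + s *: g2 - t *: g) = 0.
      have : (lin_span (NA (@Num.norm R X)) `&` range T)
          (T (g1 + s *: g2 - t *: g)).
        split; last by exists (g1 + s *: g2 - t *: g).
        have -> : T (g1 + s *: g2 - t *: g) =
            t *: (f - T g) - ((f1 - T g1) + s *: (f2 - T g2)).
          apply/val_inj/funext => y.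
          have ffy : f1 y + s * f2 y = t * f y.
            exact: (congr1 (fun k : dual_space X => k y) ff).
          transitivity (T g1 y + s * T g2 y - t * T g y).
            by rewrite -!opZ -opD -opB.
          transitivity (t * (f y - T g y) -
            ((f1 y - T g1 y) + s * (f2 y - T g2 y))).
            by rewrite mulrBr -ffy; ring.
          by [].
        have NAs := sub_lin_span (NA (@Num.norm R X)).
        apply: (lin_subspaceB _ _ _ spanNA).
          by apply: (lin_subspaceZ _ _ _ spanNA); exact: NAs.
        apply: (lin_subspaceD _ _ _ spanNA); first exact: NAs.
        by apply: (lin_subspaceZ _ _ _ spanNA); exact: NAs.
      by rewrite NAY.
    apply/eqP; rewrite -subr_eq0; apply/eqP.
    (* Summed against [T (h n) (x m)], the coefficients [b] give [T (g1 + s *: g2 - t *: g)] at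
       [x m], which is 0. *)
    pose b n := a1 n + s * a2 n - t * a n.
    suff : forall n, b n = 0 by exact.
    apply: (coefficients_unique _ (fun n m => T (h n) (x m)) b
      (1 + `|s| + `|t|)) => //.
    - move=> {}n; rewrite /b (le_trans (ler_normB _ _))// lerD//.
        rewrite (le_trans (ler_normD _ _))// lerD//.
        by rewrite normrM ler_piMr.
      by rewrite normrM ler_piMr.
    - move=> m.
      suff : (fun N => \sum_(i < N) b i * T (h i) (x m)) @ \oo -->
          T g1 (x m) + s * T g2 (x m) - t * T g (x m).
        by rewrite -!opZ -opD -opB Tg0.
      rewrite (_ : (fun N => _) = fun N => \sum_(i < N) a1 i * T (h i) (x m) +
        s * (\sum_(i < N) a2 i * T (h i) (x m)) -
        t * (\sum_(i < N) a i * T (h i) (x m))); last first.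
        apply/funext => N; rewrite !mulr_sumr -big_split/= -sumrB.
        by apply: eq_bigr => i _; rewrite /b; ring.
      by apply: cvgB; [apply: cvgD; [exact: s1|]|];
        apply: cvgM => //; exact: cvg_cst.
  have a3E : forall n, a1 n + 1 * a2 n = al * a3 n.
    apply: (key 1 al _ _ _ al0 _ u3 le3 s3).
    by rewrite scale1r scalerA mulfV ?gt_eqF// scale1r.
  have a4E : forall n, a1 n + -1 * a2 n = be * a4 n.
    apply: (key (-1) be _ _ _ be0 _ u4 le4 s4).
    by rewrite scaleN1r scalerA mulfV ?gt_eqF// scale1r.
  have [|n nP] := exists_common_nonvanishing _ _ _ T M d h [:: z1; z2; z3; z4]
    M0 TM dT hd.
    have sep (f : dual_space X) z : f z != 0 -> exists2 w, range T w & w z != 0.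
      exact: weak_star_dense_separates.
    by move=> z; rewrite !inE => /or4P[] /eqP ->;
      [exact: sep fz1|exact: sep fz2|exact: sep fz3|exact: sep fz4].
  have {nP} [nz1 nz2 nz3 nz4] : [/\ T (h n) z1 != 0, T (h n) z2 != 0,
      T (h n) z3 != 0 & T (h n) z4 != 0].
    by split; apply: nP; rewrite !inE eqxx ?orbT.
  have abs_ne0 (r : R) : `|r| = 1 -> r != 0.
    by move=> r1; rewrite -normr_eq0 r1 oner_eq0.
  have sgn (r : R) : `|r| = 1 -> r = 1 \/ r = -1.
    move=> r1; have [r0|r0] := leP 0 r.
      by left; rewrite -r1 ger0_norm.
    by right; rewrite -r1 ltr0_norm// opprK.
  (* Both [al * a3 n] and [be * a4 n] are nonzero, yet they are the sum and the difference of two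
     signs, one of which is 0. *)
  have := mulf_neq0 (lt0r_neq0 al0) (abs_ne0 _ (e3 _ nz3)).
  have := mulf_neq0 (lt0r_neq0 be0) (abs_ne0 _ (e4 _ nz4)).
  rewrite -a3E -a4E mul1r mulN1r.
  have [->|->] := sgn _ (e1 _ nz1); have [->|->] := sgn _ (e2 _ nz2);
    by rewrite ?subrr ?opprK ?addNr ?eqxx.
have pairs (f1 f2 : dual_space X) : lin_indep [tuple f1; f2] ->
    NA p f1 -> NA p f2 -> dual_norm p f1 = 1 -> dual_norm p f2 = 1 ->
    ~ NA p (f1 + f2) \/ ~ NA p (f1 - f2).
  move=> f12 NA1 NA2 p1 p2; apply/not_andP => -[NAD NAB].
  exact: (no_pair f1 f2).
by exists p; split=> //; exact: Read_norm_of_pairs.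
Qed.
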